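(* Let $R$ be a ring and let $\preceq$ be a binary relation on $R$. Then $(R,\preceq)$ is a quasi-ordered ring if and only if it is either an ordered ring or there is a unique valuation $v$ on $R$ (up to equivalence) such that for all $x,y\in R$: $x\preceq y \Leftrightarrow v(y)\le v(x)$. Moreover, the support of the quasi-ordering coincides with the support of the ordering, respectively with the support of the valuation.
   Context: Rings have a unit $1$ and are not necessarily commutative. Quasi-ordered ring: for a reflexive, transitive and total binary relation $\preceq$ on a ring $R$, write $x\sim y$ if $x\preceq y$ and $y\preceq x$; write $x\prec y$ if $x\preceq y$ but not $y\preceq x$; write $x\nsim y$ if not $x\sim y$. $(R,\preceq)$ is a quasi-ordered ring if $\preceq$ is reflexive, transitive and total and for all $a,b,x,y,z\in R$: (QR1) $0\prec 1$; (QR2) if $0\preceq a,b$ and $x\preceq y$, then $axb\preceq ayb$; (QR3) if $0\prec a,b$ and $axb\preceq ayb$, then $x\preceq y$; (QR4) if $z\nsim y$ and $x\preceq y$, then $x+z\preceq y+z$. Its support is $\{x\in R: x\sim 0\}$. Ordered ring: $(R,\le)$ with $\le$ a reflexive, transitive and total binary relation on $R$ (not assumed antisymmetric) such that for all $a,b,x,y,z\in R$: (O1) $0<1$ (i.e. $0\le 1$ and not $1\le 0$); (O2) if $0\le a,b$ and $x\le y$, then $axb\le ayb$; (O3) if $xy\le 0$, then $x\le 0$ or $y\le 0$; (O4) if $x\le y$, then $x+z\le y+z$. Its support is $\{x\in R: 0\le x \text{ and } x\le 0\}$. Valuation: let $(\Gamma,+,\le)$ be a totally ordered (order compatible with addition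 on both sides), cancellative, not necessarily commutative monoid with neutral element $0$, and $\infty$ a symbol with $\infty>\Gamma$ and $\infty=\infty+\infty=\gamma+\infty=\infty+\gamma$ for all $\gamma\in\Gamma$. A surjective map $v:R\to\Gamma\cup\{\infty\}$ is a valuation on $R$ if for all $x,y\in R$: $v(0)=\infty$; $v(1)=0$; $v(xy)=v(x)+v(y)$; $v(x+y)\ge\min\{v(x),v(y)\}$. Its support is $v^{-1}(\infty)$. Two valuations $v,w$ on $R$ are equivalent if $v(y)\le v(x)\Leftrightarrow w(y)\le w(x)$ for all $x,y\in R$. *)

(* Defs.v *)
From HB Require Import structures.
From mathcomp Require Import all_boot all_order all_algebra.
From mathcomp Require Import boolp classical_sets.

Set Implicit Arguments.
Unset Strict Implicit.
Unset Printing Implicit Defensive.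

Import Order.TTheory GRing.Theory.

Local Open Scope classical_set_scope.
Local Open Scope ring_scope.

(* pzRingType does not exclude the zero ring; the axiom 0 < 1, respectively
   v 0 = oo and v 1 = 0, does. *)

Section RelationsOnRings.
Variables (R : pzRingType) (le : R -> R -> Prop).

Definition rsim (x y : R) : Prop := le x y /\ le y x.
Definition rlt (x y : R) : Prop := le x y /\ ~ le y x.

Record quasi_ordered_ring : Prop := QuasiOrderedRing {
  qr_refl : forall x, le x x;
  qr_trans : forall x y z, le x y -> le y z -> le x z;
  qr_total : forall x y, le x y \/ le y x;
  qr1 : rlt 0 1;
  qr2 : forall a b x y, le 0 a -> le 0 b -> le x y ->
          le (a * x * b) (a * y * b);
  qr3 : forall a b x y, rlt 0 a -> rlt 0 b -> le (a * x * b) (a * y * b) ->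
          le x y;
  qr4 : forall x y z, ~ rsim z y -> le x y -> le (x + z) (y + z)
}.

Definition quasi_order_support : set R := [set x | rsim x 0].

(* Antisymmetry is not required: the support may be nonzero. *)
Record ordered_ring : Prop := OrderedRing {
  or_refl : forall x, le x x;
  or_trans : forall x y z, le x y -> le y z -> le x z;
  or_total : forall x y, le x y \/ le y x;
  or1 : rlt 0 1;
  or2 : forall a b x y, le 0 a -> le 0 b -> le x y ->
          le (a * x * b) (a * y * b);
  or3 : forall x y, le (x * y) 0 -> le x 0 \/ le y 0;
  or4 : forall x y z, le x y -> le (x + z) (y + z)
}.

Definition order_support : set R := [set x | le 0 x /\ le x 0].

End RelationsOnRings.

(* Totally ordered cancellative monoids, not necessarily commutative.  They are
   built on the library's multiplicative monoidType (its additive structures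
   are all commutative), so the usual additive notation (Gamma, +, 0) of value
   monoids becomes ( *%g, 1%g ). *)
HB.mixin Record Monoid_isOrderedCancel (d : Order.disp_t) G
    of Monoid G & Order.Total d G := {
  ocmulgI : forall x y z : G, (x * y)%g = (x * z)%g -> y = z;
  ocmulIg : forall x y z : G, (y * x)%g = (z * x)%g -> y = z;
  oclemul2l : forall x y z : G, (y <= z)%O -> (x * y <= x * z)%O%g;
  oclemul2r : forall x y z : G, (y <= z)%O -> (y * x <= z * x)%O%g
}.

#[short(type="ocMonoidType")]
HB.structure Definition OrderedCancelMonoid (d : Order.disp_t) :=
  { G of Monoid_isOrderedCancel d G & Monoid G & Order.Total d G }.

(* Gamma with oo adjoined is option Gamma, where None is oo. *)
Section ValueMonoid.
Variables (d : Order.disp_t) (G : ocMonoidType d).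

Definition vadd (a b : option G) : option G :=
  if (a, b) is (Some x, Some y) then Some (x * y)%g else None.

Definition vle (a b : option G) : bool :=
  match a, b with
  | _, None => true
  | None, Some _ => false
  | Some x, Some y => (x <= y)%O
  end.

Definition vmin (a b : option G) : option G := if vle a b then a else b.

End ValueMonoid.

Record valuation (R : pzRingType) := Valuation {
  vdisp : Order.disp_t;
  vmonoid : ocMonoidType vdisp;
  vfun :> R -> option vmonoid;
  valuation_surj : forall g : option vmonoid, exists x, vfun x = g;
  valuation0 : vfun 0 = None;
  valuation1 : vfun 1 = Some 1%g;
  valuationM : forall x y, vfun (x * y) = vadd (vfun x) (vfun y);
  valuationD : forall x y, vle (vmin (vfun x) (vfun y)) (vfun (x + y))
}.

Section Valuations.
Variable R : pzRingType.
Implicit Types v w : valuation R.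

Definition valuation_support v : set R := v @^-1` [set None].

Definition valuation_equiv v w : Prop :=
  forall x y, vle (v y) (v x) <-> vle (w y) (w x).

(* The relation le is the one defined by the valuation v. *)
Definition induced_by (le : R -> R -> Prop) v : Prop :=
  forall x y, le x y <-> vle (v y) (v x).

Definition uniquely_induced_by_valuation (le : R -> R -> Prop) : Prop :=
  exists2 v : valuation R, induced_by le v &
    forall w : valuation R, induced_by le w -> valuation_equiv v w.

End Valuations.

(* Main.v *)
From HB Require Import structures.
Require Import Defs.
From mathcomp Require Import all_boot all_order all_algebra.
From mathcomp Require Import boolp classical_sets.

Set Implicit Arguments.
Unset Strict Implicit.
Unset Printing Implicit Defensive.

Import Order.TTheory GRing.Theory.

Local Open Scope ring_scope.

(** The only case of the order axiom (O4) that (QR4) leaves out is the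
    translation of [x <= y] by an element equivalent to [y].  What decides
    between orders and valuations is the sign of [-1].

    If [-1] is negative, then [x] and [- x] are both nonnegative only when [x]
    is in the support.  Nonnegative elements are closed under addition: when
    [x + y <= 0], adding [- x] (which is legitimate unless [x] is in the
    support) squeezes [y] between [0] and [- x], so that [x] is in the support
    after all; and adding an element of the support never changes a class
    ([rsimDr]).  It then follows that [x <= y] means [0 <= y - x], a condition
    invariant under every translation, so the quasi-order is an order
    ([ordered_of_neg_opp1]).

    If [-1] is nonnegative, then every element is nonnegative, and [x] and
    [- x] are equivalent, because the comparison between [1] and [-1] can be
    multiplied by anything.  Now (QR4) gives the ultrametric inequality: unless
    [x + y] is equivalent to [x], the inequality [0 <= x] may be translated by
    [- (x + y)], which yields [- (x + y) <= - y], i.e. [x + y <= y]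
    ([qo_ultrametric]).  Moreover (QR2) and (QR3) say that multiplication is
    monotone and cancellative modulo the support.  Hence the equivalence
    classes outside the support form, for the reversed order, an ordered
    cancellative monoid, and sending an element to its class is a valuation
    that induces the quasi-order ([induced_by_class_valuation]).

    Conversely both structures satisfy (QR1)-(QR4) by direct verification, and
    no relation is of both kinds, since a valuation makes [-1] nonnegative while
    translating [0 <= -1] by [1] in an order gives [1 <= 0].  Two valuations
    inducing the same relation are equivalent by definition. *)

(** * Support and signs in a quasi-ordered ring *)

Section QuasiOrder.
Variables (R : pzRingType) (le : R -> R -> Prop).
Hypothesis Q : quasi_ordered_ring le.
Implicit Types x y z a b d : R.

Local Notation "x <~ y" := (le x y) (at level 70).
Local Notation "x <~> y" := (rsim le x y) (at level 70).

Let le_refl := qr_refl Q.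
Let le_trans := qr_trans Q.
Let le_total := qr_total Q.

Lemma rsim_sym x y : x <~> y -> y <~> x.
Proof. by case. Qed.

Lemma rsim_trans x y z : x <~> y -> y <~> z -> x <~> z.
Proof.
by move=> [xy yx] [yz zy]; split; [apply: le_trans yz | apply: le_trans yx].
Qed.

Lemma rsim0_congr x y : x <~> y -> x <~> 0 -> y <~> 0.
Proof. by move=> /rsim_sym; apply: rsim_trans. Qed.

Lemma not_le_total x y : ~ x <~ y -> y <~ x.
Proof. by case: (le_total x y). Qed.

Lemma qo_le01 : 0 <~ 1.
Proof. by have [] := qr1 Q. Qed.

Lemma le_mull x y z : 0 <~ x -> y <~ z -> x * y <~ x * z.
Proof.
move=> x0 yz; have := qr2 Q x0 qo_le01 yz.
by rewrite !mulr1.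
Qed.

Lemma le_mulr x y z : 0 <~ x -> y <~ z -> y * x <~ z * x.
Proof.
move=> x0 yz; have := qr2 Q qo_le01 x0 yz.
by rewrite !mul1r.
Qed.

Lemma le_mull_cancel x y z : rlt le 0 x -> x * y <~ x * z -> y <~ z.
Proof. by move=> x0 yz; apply: (qr3 Q x0 (qr1 Q)); rewrite !mulr1. Qed.

Lemma le_mulr_cancel x y z : rlt le 0 x -> y * x <~ z * x -> y <~ z.
Proof. by move=> x0 yz; apply: (qr3 Q (qr1 Q) x0); rewrite !mul1r. Qed.

(** Each inequality translates by [- x]; the side condition of (QR4) can only
    fail if [- x] is equivalent to [0] or to [x], which is the claim itself. *)
Lemma rsim0N x : x <~> 0 -> - x <~> 0.
Proof.
move=> x0; apply: contrapT => Nx0; have [x_le0 x_ge0] := x0; apply: Nx0.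
split.
  have [/rsim_trans/(_ x0)[]//|Nxx] := pselect (- x <~> x).
  by have := qr4 Q Nxx x_ge0; rewrite add0r subrr.
have [[]//|Nx0] := pselect (- x <~> 0).
by have := qr4 Q Nx0 x_le0; rewrite add0r subrr.
Qed.

Lemma oppr_ge0_of_le0 x : x <~ 0 -> 0 <~ - x.
Proof.
move=> x_le0; have [[]//|Nx0] := pselect (- x <~> 0).
by have := qr4 Q Nx0 x_le0; rewrite add0r subrr.
Qed.

(** Outside the support this is (QR4) applied to [d <= 0] and [0 <= d]; inside,
    it says that the support is an additive subgroup. *)
Lemma rsimDr y d : d <~> 0 -> y + d <~> y.
Proof.
have outside z e : e <~> 0 -> ~ z <~> 0 -> z + e <~> z.
  move=> e0 z0; have [e_le0 e_ge0] := e0; split.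
    by have := qr4 Q z0 e_le0; rewrite add0r addrC.
  have ze : ~ z <~> e by move=> /rsim_trans/(_ e0).
  by have := qr4 Q ze e_ge0; rewrite add0r addrC.
move=> d0; have [y0|] := pselect (y <~> 0); last exact: outside.
(* If y + d were outside the support, subtracting y would keep its class;
   but the difference is d. *)
have [yd0|yd0] := pselect (y + d <~> 0).
  exact: rsim_trans yd0 (rsim_sym y0).
have := outside _ _ (rsim0N y0) yd0; rewrite addrAC subrr add0r => /rsim_sym.
by move=> /rsim_trans/(_ d0).
Qed.

(** * Negative [-1]: ordered rings *)

Section NegativeOpp1.
Hypothesis N1_neg : ~ 0 <~ -1.

(** If [0 < x], then [x] cancels from [x * 0 <= x * (-1)], against the sign of
    [-1]. *)
Lemma ge0_opp_rsim0 x : 0 <~ x -> 0 <~ - x -> x <~> 0.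
Proof.
move=> x_ge0 Nx_ge0; split=> //; apply: contrapT => x_gt0.
apply: N1_neg; apply: (@le_mull_cancel x); first by split.
by rewrite mulr0 mulrN1.
Qed.

(** If [x + y <= 0] with [x] outside the support, translating by [- x] gives
    [0 <= y <= - x], so [x] is in the support by [ge0_opp_rsim0]. *)
Lemma qo_addr_ge0 x y : 0 <~ x -> 0 <~ y -> 0 <~ x + y.
Proof.
move=> x_ge0 y_ge0; have [//|xy_le0] := le_total 0 (x + y).
have sim0 : x <~> 0 -> 0 <~ x + y.
  by rewrite addrC => /(rsimDr y)[_]; apply: le_trans.
have [/sim0//|x0] := pselect (x <~> 0).
have Nx0 : ~ - x <~> 0 by move=> /rsim0N; rewrite opprK.
apply/sim0/ge0_opp_rsim0 => //; apply: le_trans y_ge0 _.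
by have := qr4 Q Nx0 xy_le0; rewrite add0r addrAC subrr add0r.
Qed.

(** This turns the partial translation invariance of (QR4) into a full one,
    since [y - x] is unchanged when [x] and [y] are translated together. *)
Lemma le_subr_ge0 x y : x <~ y <-> 0 <~ y - x.
Proof.
have impl u v : u <~ v -> 0 <~ v - u.
  move=> uv; have [v0|v0] := pselect (v <~> 0).
    have [v_le0 v_ge0] := v0; apply: qo_addr_ge0 => //.
    exact: oppr_ge0_of_le0 (le_trans uv v_le0).
  (* An element equivalent to its opposite is in the support. *)
  have Nvv : ~ - v <~> v.
    move=> [Nv_le v_leN]; apply: v0; have [v_ge0|v_le0] := le_total 0 v.
      by apply: ge0_opp_rsim0 => //; apply: le_trans v_leN.
    have Nv_ge0 := oppr_ge0_of_le0 v_le0.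
    by apply: ge0_opp_rsim0 => //; apply: le_trans Nv_le.
  have := qr4 Q Nvv uv; rewrite subrr => /oppr_ge0_of_le0.
  by rewrite opprB.
split=> [|xy]; first exact: impl.
have [//|/impl yx] := le_total x y.
have d0 : y - x <~> 0 by apply: ge0_opp_rsim0; rewrite // opprB.
by have [_] := rsimDr x d0; rewrite addrC subrK.
Qed.

Lemma ordered_of_neg_opp1 : ordered_ring le.
Proof.
split=> //; first exact: qr1 Q; first exact: qr2 Q.
  move=> x y xy_le0; have [|x_gt0] := pselect (x <~ 0); [by left | right].
  apply: (@le_mull_cancel x); last by rewrite mulr0.
  by split=> //; apply: not_le_total.
move=> x y z /le_subr_ge0 xy; apply/le_subr_ge0.
by rewrite opprD addrACA subrr addr0.
Qed.

End NegativeOpp1.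

(** * Nonnegative [-1]: valued rings *)

Section NonnegativeOpp1.
Hypothesis N1_ge0 : 0 <~ -1.

Lemma qo_ge0 x : 0 <~ x.
Proof.
have [//|/oppr_ge0_of_le0 Nx_ge0] := le_total 0 x.
by have := le_mull Nx_ge0 N1_ge0; rewrite mulr0 mulrN1 opprK.
Qed.

(** Whichever of [1 <= -1] and [-1 <= 1] holds, it can be multiplied by [- y],
    respectively [y], as nothing is negative. *)
Lemma rsimN x : - x <~> x.
Proof.
suff leN y : - y <~ y by split; rewrite // -[X in X <~ _]opprK.
have [le1N|leN1] := le_total 1 (-1).
  by have := le_mull (qo_ge0 (- y)) le1N; rewrite mulrN1 mulr1 opprK.
by have := le_mull (qo_ge0 y) leN1; rewrite mulrN1 mulr1.
Qed.

(** The translation used is [0 <= x] by [- (x + y)], allowed by (QR4) unless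
    [x + y] is equivalent to [x]. *)
Lemma qo_ultrametric x y : x + y <~ x \/ x + y <~ y.
Proof.
have [[]|Nsim] := pselect (x + y <~> x); [by left | right].
have Nx : ~ - (x + y) <~> x by move=> /(rsim_trans (rsim_sym (rsimN _))).
have := qr4 Q Nx (qo_ge0 x).
rewrite add0r opprD addrA subrr add0r -opprD => le_xyN.
have [_ le_xy] := rsimN (x + y); have [le_y _] := rsimN y.
exact: le_trans le_xy (le_trans le_xyN le_y).
Qed.

Lemma rsimM x x' y y' : x <~> x' -> y <~> y' -> x * y <~> x' * y'.
Proof.
move=> [xx' x'x] [yy' y'y]; split.
  exact: le_trans (le_mulr (qo_ge0 _) xx') (le_mull (qo_ge0 _) yy').
exact: le_trans (le_mulr (qo_ge0 _) x'x) (le_mull (qo_ge0 _) y'y).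
Qed.

Lemma gt0_of_nsim0 x : ~ x <~> 0 -> rlt le 0 x.
Proof.
by move=> x0; split=> [|x_le0]; [|apply: x0; split=> //]; exact: qo_ge0.
Qed.

Lemma mulr_nsim0 x y : ~ x <~> 0 -> ~ y <~> 0 -> ~ x * y <~> 0.
Proof.
move=> x0 y0 [xy_le0 _]; apply: y0; split; last exact: qo_ge0.
by apply: (le_mull_cancel (gt0_of_nsim0 x0)); rewrite mulr0.
Qed.

End NonnegativeOpp1.

(** * Representatives of equivalence classes *)

Definition class_rep x : R := choose (fun y => `[< y <~> x >]) x.

Lemma class_repP x : class_rep x <~> x.
Proof.
apply/asboolP; apply: (@chooseP _ (fun y => `[< y <~> x >])).
by apply/asboolP; split; apply: le_refl.
Qed.

Lemma eq_class_rep x y : x <~> y -> class_rep x = class_rep y.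
Proof.
move=> xy; have eqP : (fun z => `[< z <~> x >]) =1 (fun z => `[< z <~> y >]).
  move=> z; apply/asboolP/asboolP => zx; first exact: rsim_trans xy.
  exact: rsim_trans (rsim_sym xy).
rewrite /class_rep (eq_choose eqP); apply: choose_id.
  exact/asboolP.
by apply/asboolP; split; apply: le_refl.
Qed.

(** Chosen representatives realize the quotient by [<~>] as a subtype of [R],
    and an element of the support gets no value there, hence infinity. *)
Definition is_value : pred R :=
  fun x => (class_rep x == x) && ~~ `[< x <~> 0 >].

(** The proof arguments make the two hypotheses recoverable from the type, as
    the structure instances attached to it depend on them. *)
Definition class_monoid of quasi_ordered_ring le & 0 <~ -1 :=
  {x : R | is_value x}.

End QuasiOrder.

(** * Totally ordered values with infinity *)

Section ExtendedValues.
Variables (d : Order.disp_t) (G : ocMonoidType d).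
Implicit Types a b c : option G.

Lemma vle_refl a : vle a a.
Proof. by case: a => //= g; apply: lexx. Qed.

Lemma vle_trans a b c : vle a b -> vle b c -> vle a c.
Proof. by case: a b c => [a|] [b|] [c|] //=; apply: le_trans. Qed.

Lemma vle_total a b : vle a b \/ vle b a.
Proof.
by case: a b => [a|] [b|] /=; auto; apply/orP; apply: le_total.
Qed.

Lemma vle_min a b c : vle (vmin a b) c <-> vle a c \/ vle b c.
Proof.
rewrite /vmin; case: ifPn => [ab|/negP Nab].
  by split=> [|[//|]]; [left | apply: vle_trans].
split=> [|[ac|//]]; first by right.
by case: (vle_total a b) => // ba; apply: vle_trans ba ac.
Qed.

Lemma vle_vadd a b c e : vle a b -> vle c e -> vle (vadd a c) (vadd b e).
Proof.
case: a b c e => [a|] [b|] [c|] [e|] //= ab ce.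
by apply: le_trans (oclemul2r _ _ _ ab) (oclemul2l _ _ _ ce).
Qed.

Lemma ocmul_le_cancel (x y z t : G) :
  (x * y * t <= x * z * t)%O%g -> (y <= z)%O.
Proof.
move=> xyz; have /orP[//|zy] := le_total y z.
have zyx := oclemul2r t _ _ (oclemul2l x _ _ zy).
suff -> : y = z by [].
by apply/(@ocmulgI _ _ x)/(@ocmulIg _ _ t)/eqP; rewrite eq_le xyz.
Qed.

Lemma ocmul_sqr1 (g : G) : (g * g = 1)%g -> g = 1%g.
Proof.
move=> gg; apply: le_anti.
have /orP[g1|g1] := le_total g 1%g; rewrite g1 ?andbT /=.
  by have := oclemul2l g _ _ g1; rewrite gg mulg1.
by have := oclemul2l g _ _ g1; rewrite gg mulg1.
Qed.

End ExtendedValues.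

(** * The valuation by equivalence classes *)

Section ClassMonoid.
Variables (R : pzRingType) (le : R -> R -> Prop).
Hypotheses (Q : quasi_ordered_ring le) (N1_ge0 : le 0 (-1)).
Implicit Types x y : R.

Local Notation "x <~ y" := (le x y) (at level 70).
Local Notation "x <~> y" := (rsim le x y) (at level 70).
Local Notation G := (class_monoid Q N1_ge0).
Local Notation is_value := (is_value le).
Local Notation class_rep := (class_rep le).

HB.instance Definition _ := SubChoice.copy G {x : R | is_value x}.

Implicit Types u v w : G.

Lemma class_rep_is_value x : ~ x <~> 0 -> is_value (class_rep x).
Proof.
move=> x0; apply/andP; split.
  by apply/eqP; apply: (eq_class_rep Q); apply: (class_repP Q).
by apply/asboolPn => /(rsim0_congr Q (class_repP Q x)).
Qed.

Lemma val_nsim0 u : ~ val u <~> 0.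
Proof. by have /andP[_ /asboolPn] := valP u. Qed.

Lemma val_rsim_inj u v : val u <~> val v -> u = v.
Proof.
move=> uv; apply: val_inj.
have /andP[/eqP <- _] := valP u; have /andP[/eqP <- _] := valP v.
exact: eq_class_rep.
Qed.

Definition class_of x (x0 : ~ x <~> 0) : G := Sub _ (class_rep_is_value x0).

Lemma val_class_of x (x0 : ~ x <~> 0) : val (class_of x0) <~> x.
Proof. by rewrite SubK; apply: class_repP. Qed.

Lemma nsim10 : ~ 1 <~> 0.
Proof. by case: (qr1 Q) => _ N10 []. Qed.

Definition class_one : G := class_of nsim10.

Definition class_mul u v : G :=
  class_of (mulr_nsim0 Q N1_ge0 (val_nsim0 (u := u)) (val_nsim0 (u := v))).

Lemma val_class_mul u v : val (class_mul u v) <~> val u * val v.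
Proof. exact: val_class_of. Qed.

Let rsim_refl x : x <~> x.
Proof. by split; apply: (qr_refl Q). Qed.
Let congrM := rsimM Q N1_ge0.

Lemma class_mulA : associative class_mul.
Proof.
move=> u v w; apply: val_rsim_inj.
have uvw := rsim_trans Q (val_class_mul u (class_mul v w))
  (congrM (rsim_refl (val u)) (val_class_mul v w)).
apply: (rsim_trans Q uvw); rewrite mulrA; apply: rsim_sym.
exact: (rsim_trans Q (val_class_mul (class_mul u v) w)
  (congrM (val_class_mul u v) (rsim_refl (val w)))).
Qed.

Lemma class_mul1g : left_id class_one class_mul.
Proof.
move=> u; apply: val_rsim_inj.
apply: (rsim_trans Q (val_class_mul class_one u)).
by have := congrM (val_class_of nsim10) (rsim_refl (val u)); rewrite mul1r.
Qed.

Lemma class_mulg1 : right_id class_one class_mul.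
Proof.
move=> u; apply: val_rsim_inj.
apply: (rsim_trans Q (val_class_mul u class_one)).
by have := congrM (rsim_refl (val u)) (val_class_of nsim10); rewrite mulr1.
Qed.

HB.instance Definition _ := isMonoid.Build G class_mulA class_mul1g class_mulg1.

(** Reversed, as small elements have large values. *)
Definition class_le u v : bool := `[< val v <~ val u >].

Fact class_display : Order.disp_t. Proof. exact: Order.Disp tt tt. Qed.

Lemma class_le_refl : reflexive class_le.
Proof. by move=> u; apply/asboolP/(qr_refl Q). Qed.

Lemma class_le_anti : antisymmetric class_le.
Proof.
by move=> u v /andP[/asboolP vu /asboolP uv]; apply: val_rsim_inj.
Qed.

Lemma class_le_trans : transitive class_le.
Proof.
move=> v u w /asboolP vu /asboolP wv; apply/asboolP.
exact: (qr_trans Q) vu.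
Qed.

HB.instance Definition _ := Order.Le_isPOrder.Build class_display G
  class_le_refl class_le_anti class_le_trans.

Lemma class_le_total : total (<=%O : rel G).
Proof.
move=> u v; apply/orP.
by have [?|?] := qr_total Q (val u) (val v); [right | left]; apply/asboolP.
Qed.

HB.instance Definition _ :=
  Order.POrder_isTotal.Build class_display G class_le_total.

Lemma class_leP u v : reflect (val v <~ val u) (u <= v)%O.
Proof. exact: asboolP. Qed.

Lemma class_leM (u v w z : G) :
  (u * v <= w * z)%O%g <-> val w * val z <~ val u * val v.
Proof.
have [uvle leuv] := val_class_mul u v; have [wzle lewz] := val_class_mul w z.
split=> [/class_leP wz | wz].
  exact: (qr_trans Q (qr_trans Q lewz wz) uvle).
by apply/class_leP; apply: (qr_trans Q (qr_trans Q wzle wz) leuv).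
Qed.

Lemma class_lemul2l u v w : (v <= w)%O -> (u * v <= u * w)%O%g.
Proof.
by move=> /class_leP vw; apply/class_leM/(le_mull Q)/vw; apply: (qo_ge0 Q).
Qed.

Lemma class_lemul2r u v w : (v <= w)%O -> (v * u <= w * u)%O%g.
Proof.
by move=> /class_leP vw; apply/class_leM/(le_mulr Q)/vw; apply: (qo_ge0 Q).
Qed.

Lemma class_gt0 u : rlt le 0 (val u).
Proof. exact: gt0_of_nsim0 (val_nsim0 (u := u)). Qed.

Lemma class_mulgI u v w : (u * v = u * w)%g -> v = w.
Proof.
move=> /eqP; rewrite eq_le => /andP[/class_leM wv /class_leM vw].
by apply: val_rsim_inj; split; apply: (le_mull_cancel Q (class_gt0 u)).
Qed.

Lemma class_mulIg u v w : (v * u = w * u)%g -> v = w.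
Proof.
move=> /eqP; rewrite eq_le => /andP[/class_leM wv /class_leM vw].
by apply: val_rsim_inj; split; apply: (le_mulr_cancel Q (class_gt0 u)).
Qed.

HB.instance Definition _ := Monoid_isOrderedCancel.Build class_display G
  class_mulgI class_mulIg class_lemul2l class_lemul2r.

(** [is_value] rejects exactly one representative, that of the support, so
    [insub] yields [None] precisely on the support. *)
Definition class_fun x : option G := insub (class_rep x).

Variant class_fun_spec x : option G -> Prop :=
| ClassFunInf of x <~> 0 : class_fun_spec x None
| ClassFunFin u of val u <~> x : class_fun_spec x (Some u).

Lemma class_funP x : class_fun_spec x (class_fun x).
Proof.
rewrite /class_fun; case: insubP => [u _ ux | xN0].
  by apply: ClassFunFin; rewrite ux; apply: class_repP.
by apply: ClassFunInf; apply: contrapT => /class_rep_is_value; apply/negP.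
Qed.

Lemma class_fun_le x y : vle (class_fun y) (class_fun x) <-> x <~ y.
Proof.
have ge0 := qo_ge0 Q N1_ge0.
case: (class_funP x) => [[x_le0 _]|u [ux xu]].
  by split=> // _; [apply: (qr_trans Q x_le0) | case: class_fun].
case: (class_funP y) => [[y_le0 _]|v [vy yv]]; split=> //.
- move=> xy; case: (@val_nsim0 u); split; last exact: ge0.
  exact: (qr_trans Q ux (qr_trans Q xy y_le0)).
- by move=> /class_leP uv; apply: (qr_trans Q xu (qr_trans Q uv vy)).
- by move=> xy; apply/class_leP/(qr_trans Q ux (qr_trans Q xy yv)).
Qed.

Lemma class_fun_eq x u : val u <~> x -> class_fun x = Some u.
Proof.
move=> ux; case: class_funP => [x0|v vx].
  by case: (@val_nsim0 u); apply: (rsim_trans Q ux x0).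
by congr Some; apply: val_rsim_inj; apply: (rsim_trans Q vx); apply: rsim_sym.
Qed.

Lemma class_fun0 x : x <~> 0 -> class_fun x = None.
Proof.
move=> x0; case: class_funP => // u ux.
by case: (@val_nsim0 u); apply: (rsim_trans Q ux x0).
Qed.

Lemma class_fun_surj (g : option G) : exists x, class_fun x = g.
Proof.
case: g => [u|]; first by exists (val u); apply: class_fun_eq.
by exists 0; apply: class_fun0.
Qed.

Lemma class_funM x y : class_fun (x * y) = vadd (class_fun x) (class_fun y).
Proof.
case: (class_funP x) => [x0|u ux].
  by apply: class_fun0; have := congrM x0 (rsim_refl y); rewrite mul0r.
case: (class_funP y) => [y0|v vy].
  by apply: class_fun0; have := congrM (rsim_refl x) y0; rewrite mulr0.
exact/class_fun_eq/(rsim_trans Q (val_class_mul u v) (congrM ux vy)).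
Qed.

Lemma class_funD x y :
  vle (vmin (class_fun x) (class_fun y)) (class_fun (x + y)).
Proof.
by apply/vle_min; have [xy|xy] := qo_ultrametric Q N1_ge0 x y; [left | right];
   apply/class_fun_le.
Qed.

Lemma class_fun1 : class_fun 1 = Some 1%g.
Proof. exact/class_fun_eq/val_class_of. Qed.

Lemma induced_by_class_valuation : exists v : valuation R, induced_by le v.
Proof.
exists (Valuation class_fun_surj (class_fun0 (rsim_refl 0)) class_fun1
  class_funM class_funD) => x y.
exact: iff_sym (class_fun_le x y).
Qed.

End ClassMonoid.

(** * Orders and valuations give quasi-orders *)

Lemma ordered_quasi_ordered (R : pzRingType) (le : R -> R -> Prop) :
  ordered_ring le -> quasi_ordered_ring le.
Proof.
move=> O; have leB x y : le x y <-> le (x - y) 0.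
  split=> xy; first by have := Defs.or4 O (- y) xy; rewrite subrr.
  by have := Defs.or4 O y xy; rewrite subrK add0r.
split; [exact: or_refl O | exact: or_trans O | exact: or_total O | exact: or1 O
  | exact: or2 O | | by move=> x y z _; apply: (Defs.or4 O)].
move=> a b x y [_ a_gt0] [_ b_gt0] /leB; rewrite -mulrBl -mulrBr => axyb.
by have [/(Defs.or3 O)[//|/(proj2 (leB x y))]|//] := Defs.or3 O axyb.
Qed.

Section ValuationOrder.
Variables (R : pzRingType) (v : valuation R).
Implicit Types x y z : R.

(** The value of [-1] squares to the neutral element, and an ordered monoid has
    no nontrivial square roots of it. *)
Lemma valuationN1 : v (-1) = Some 1%g.
Proof.
have := valuationM v (-1) (-1); rewrite mulrNN mulr1 valuation1.
by case: (v (-1)) => //= g [/esym/ocmul_sqr1 ->].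
Qed.

Lemma valuationN x : v (- x) = v x.
Proof.
rewrite -mulN1r valuationM valuationN1.
by case: (v x) => //= g; rewrite /vadd mul1g.
Qed.

(** Since [z = (y + z) - y], the value of [z] is at least that of [y + z]
    or that of [y]. *)
Lemma vle_addr y z : ~ vle (v y) (v z) -> vle (v (y + z)) (v z).
Proof.
have := valuationD v (y + z) (- y); rewrite addrAC subrr add0r valuationN.
by move=> /vle_min[].
Qed.

(** For (QR4), when [y] and [z] have distinct values, the value of [y + z] is at
    most both of them, by [vle_addr] applied to the one of smaller value, whereas
    [x + z] has at least the smaller of the values of [x] and [z]. *)
Lemma induced_by_quasi_ordered (le : R -> R -> Prop) :
  induced_by le v -> quasi_ordered_ring le.
Proof.
move=> lev; have v_gt0 a : rlt le 0 a -> exists g, v a = Some g.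
  move=> [_ a0]; case va: (v a) => [g|]; first by exists g.
  by case: a0; apply/lev; rewrite va valuation0.
split.
- by move=> x; apply/lev/vle_refl.
- by move=> x y z /lev yx /lev zy; apply/lev/(vle_trans zy yx).
- move=> x y.
  by have [yx|xy] := vle_total (v y) (v x); [left | right]; apply/lev.
- by split; rewrite lev valuation0 valuation1.
- move=> a b x y _ _ /lev yx; apply/lev; rewrite !valuationM.
  exact: vle_vadd (vle_vadd (vle_refl _) yx) (vle_refl _).
- move=> a b x y /v_gt0[g va] /v_gt0[h vb] /lev; rewrite !valuationM va vb lev.
  by case: (v x) (v y) => [p|] [q|] //; apply: ocmul_le_cancel.
move=> x y z zy /lev yx; apply/lev.
suff yz : vle (v (y + z)) (v y) /\ vle (v (y + z)) (v z).
  have /vle_min[xz|xz] := valuationD v x z; last exact: vle_trans yz.2 xz.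
  exact: vle_trans yz.1 (vle_trans yx xz).
have [yz|zy'] := vle_total (v y) (v z).
  have Nzy : ~ vle (v z) (v y) by move=> zy'; apply: zy; split; apply/lev.
  have yzy : vle (v (y + z)) (v y) by rewrite addrC; apply: vle_addr.
  by split=> //; apply: vle_trans yz.
have Nyz : ~ vle (v y) (v z) by move=> yz; apply: zy; split; apply/lev.
have yzz := vle_addr Nyz; split=> //; exact: vle_trans zy'.
Qed.

Lemma induced_by_support (le : R -> R -> Prop) :
  induced_by le v -> quasi_order_support le = valuation_support v.
Proof.
move=> lev; apply/seteqP; split=> x.
  by case=> /lev vx _; move: vx; rewrite valuation0 /valuation_support /=;
     case: (v x).
by move=> vx; split; apply/lev; rewrite valuation0 vx.
Qed.

Lemma induced_by_not_ordered (le : R -> R -> Prop) :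
  induced_by le v -> ~ ordered_ring le.
Proof.
move=> lev O; have [_ N10] := or1 O; apply: N10.
have N1_ge0 : le 0 (-1) by rewrite lev valuation0; case: (v _).
by have := Defs.or4 O 1 N1_ge0; rewrite add0r addNr.
Qed.

End ValuationOrder.

Lemma induced_by_unique (R : pzRingType) (le : R -> R -> Prop)
    (v : valuation R) :
  induced_by le v -> uniquely_induced_by_valuation le.
Proof.
by move=> lev; exists v => // w lew x y; rewrite -lev -lew.
Qed.

(* The second conjunct expresses that "either ... or" is exclusive. *)
Theorem theorem2p19 (R : pzRingType) (le : R -> R -> Prop) :
  [/\ quasi_ordered_ring le <->
        ordered_ring le \/ uniquely_induced_by_valuation le,
      ~ (ordered_ring le /\ uniquely_induced_by_valuation le),
      ordered_ring le -> quasi_order_support le = order_support le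
    & forall v : valuation R, induced_by le v ->
        quasi_order_support le = valuation_support v].
Proof.
split.
- split=> [Q|[O|[v lev _]]]; last exact: induced_by_quasi_ordered lev.
    have [N1_ge0|N1_neg] := pselect (le 0 (-1)); [right | left].
      have [v lev] := induced_by_class_valuation Q N1_ge0.
      exact: induced_by_unique lev.
    exact: ordered_of_neg_opp1 Q N1_neg.
  exact: ordered_quasi_ordered O.
- by move=> [O [v lev _]]; apply: induced_by_not_ordered lev O.
- by move=> _; apply/seteqP; split=> x /= [].
- by move=> v; apply: induced_by_support.
Qed.
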